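(* Let $B_1,B_2\ge0$ with at least one of $B_1,B_2$ positive. There exist constants $c_1,c_2>0$, depending only on $B_1,B_2$, such that the following holds. Let $X$ be a random variable with CDF $F$ taking values in $[-B_2,B_1]$ almost surely, and let $\rho:\mathcal{L}\to\mathbb{R}$ be a risk measure of type (T2) with parameters $\alpha_1,\alpha_2,\alpha_3,L_1,L_2,L_3,K_1,K_2,\gamma$. Let $\rho_n=\rho(F_n)$ and $\tau=\max\left\{\frac{B_1}{K_1},\frac{B_2}{K_2}\right\}$. Then, for every $\epsilon>0$ and $n\ge1$, $$\mathbb{P}\left(|\rho_n-\rho(X)|>\epsilon\right)\le c_1\exp\left(-c_2n\left[\frac{\epsilon}{L_1\tau^\gamma}\right]^{2/\alpha_1}\right).$$
   Context: $\mathcal{L}$ is the set of CDFs on $\mathbb{R}$. A risk measure is a map $\rho:\mathcal{L}\to\mathbb{R}$; if $X$ has CDF $F$, $\rho(X)$ means $\rho(F)$. For a CDF $G$ and $\tau>0$, $G|_\tau(x)=G(x)\mathbf 1\{-\tau\le x<\tau\}+\mathbf 1\{x\ge\tau\}$. $\rho$ is of type (T2) with parameters $\alpha_1,\alpha_2,\alpha_3,L_1,L_2,L_3,K_1,K_2,\gamma$ (all positive constants, with $\alpha_1,K_1,K_2\le1$) if for all $F,G\in\mathcal{L}$ and every $\tau>0$, $$|\rho(F)-\rho(G|_\tau)|\le L_1(W_1(F,G))^{\alpha_1}\tau^\gamma+L_2\int_{K_1\tau}^\infty[1-F(z)]^{\alpha_2}dz+L_3\int_{-\infty}^{-K_2\tau}[F(z)]^{\alpha_3}dz.$$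 $W_1$ is the 1-Wasserstein distance: $W_1(F_1,F_2)=\inf\int_{\mathbb{R}^2}|x-y|\,dF(x,y)$ over joint distributions $F$ with marginals $F_1,F_2$; equivalently $W_1(F_1,F_2)=\int_{-\infty}^{\infty}|F_1(s)-F_2(s)|\,ds$. Given i.i.d. samples $X_1,\dots,X_n$ from $F$, $F_n(x)=\frac1n\sum_{i=1}^n\mathbf 1\{X_i\le x\}$ is the empirical distribution function. *)

(* Defs.v *)
From HB Require Import structures.
From mathcomp Require Import all_boot all_order all_algebra.
From mathcomp Require Import all_classical all_reals all_analysis.

Set Implicit Arguments.
Unset Strict Implicit.
Unset Printing Implicit Defensive.

Import Order.TTheory GRing.Theory Num.Theory.
Import numFieldNormedType.Exports.

Local Open Scope classical_set_scope.
Local Open Scope ring_scope.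

Notation CDF R := (@cumulativeBounded R 0 1).

Definition risk_measure (R : realType) := CDF R -> R.

Section truncation.
Context {R : realType} (G : CDF R) (tau : R).

Definition trunc (x : R) : R :=
  G x * (- tau <= x < tau)%R%:R + (tau <= x)%R%:R.

Lemma CDF_ge0 (H : CDF R) (x : R) : 0 <= H x.
Proof.
rewrite leNgt; apply/negP => Hx.
have /cvgrPdist_lt/(_ _ (_ : 0 < - H x)) := cumulativeNy H.
rewrite oppr_gt0 => /(_ Hx) [M [_ HM]].
have /= := HM (Num.min (M - 1) x); rewrite gt_min ltrBlDr ltrDl ltr01 => /(_ isT).
have := @cumulative_is_nondecreasing _ _ _ H (Num.min (M - 1) x) x.
rewrite ge_min lexx orbT => /(_ isT) H1.
rewrite sub0r normrN ltr0_norm ?ltrN2 ?(le_lt_trans H1)// => H2.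
by have := lt_le_trans H2 H1; rewrite ltxx.
Qed.

Lemma CDF_le1 (H : CDF R) (x : R) : H x <= 1.
Proof.
rewrite leNgt; apply/negP => Hx.
have /cvgrPdist_lt/(_ _ (_ : 0 < H x - 1)) := cumulativey H.
rewrite subr_gt0 => /(_ Hx) [M [_ HM]].
have /= := HM (Num.max (M + 1) x); rewrite lt_max ltrDl ltr01 => /(_ isT).
have := @cumulative_is_nondecreasing _ _ _ H x (Num.max (M + 1) x).
rewrite le_max lexx orbT => /(_ isT) H1.
rewrite distrC ger0_norm ?subr_ge0 ?(ltW (lt_le_trans Hx H1))//.
by rewrite ltrD2r => H2; have := lt_le_trans H2 H1; rewrite ltxx.
Qed.

Let trunc_ge (x : R) : tau <= x -> trunc x = 1.
Proof. by move=> h; rewrite /trunc h ltNge h andbF mulr0 add0r. Qed.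

Let trunc_mid (x : R) : - tau <= x -> x < tau -> trunc x = G x.
Proof. by move=> h1 h2; rewrite /trunc h1 h2 leNgt h2 mulr1 addr0. Qed.

Let trunc_lt (x : R) : x < - tau -> x < tau -> trunc x = 0.
Proof. by move=> h1 h2; rewrite /trunc (leNgt (- tau)) h1 leNgt h2 mulr0 addr0. Qed.

Let trunc_nd : nondecreasing trunc.
Proof.
move=> x y xy; have [ty|yt] := leP tau y.
  rewrite (trunc_ge ty); have [tx|xt] := leP tau x; first by rewrite trunc_ge.
  have [tx|xt'] := leP (- tau) x; first by rewrite trunc_mid ?CDF_le1.
  by rewrite trunc_lt.
have xt := le_lt_trans xy yt.
have [tx|xt'] := leP (- tau) x.
  by rewrite !trunc_mid ?(le_trans tx xy)//; exact: cumulative_is_nondecreasing.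
rewrite trunc_lt//; have [ty|yt'] := leP (- tau) y.
  by rewrite trunc_mid ?CDF_ge0.
by rewrite trunc_lt.
Qed.

Let trunc_rc : right_continuous trunc.
Proof.
move=> a; have [ta|lat] := leP tau a.
  rewrite trunc_ge//; apply: cvg_near_cst; near=> x.
  by rewrite trunc_ge// (le_trans ta)// ltW.
have [ta|at'] := leP (- tau) a.
  rewrite trunc_mid//.
  apply: cvg_trans (@cumulative_is_right_continuous _ _ _ G a).
  apply: near_eq_cvg; near=> x.
  by rewrite trunc_mid ?(le_trans ta)// ltW.
rewrite trunc_lt//; apply: cvg_near_cst; near=> x.
by rewrite trunc_lt.
Unshelve. all: by end_near. Qed.

HB.instance Definition _ := isCumulative.Build R _ R trunc trunc_nd trunc_rc.

Let truncNy : trunc @ -oo --> (0 : R).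
Proof.
apply: cvg_near_cst; near=> x.
by rewrite trunc_lt//; near: x; apply: nbhs_ninfty_lt; rewrite num_real.
Unshelve. all: by end_near. Qed.

Let truncy : trunc @ +oo --> (1 : R).
Proof.
apply: cvg_near_cst; near=> x.
by rewrite trunc_ge//; near: x; apply: nbhs_pinfty_ge; rewrite num_real.
Unshelve. all: by end_near. Qed.

HB.instance Definition _ := isCumulativeBounded.Build R 0 1 trunc truncNy truncy.

End truncation.

(* A sample of size n.+1, so that the empirical distribution function is a
   CDF. *)
Section empirical_cdf.
Context {R : realType} (n : nat) (x : 'I_n.+1 -> R).

Definition ecdf (t : R) : R := n.+1%:R^-1 * \sum_(i < n.+1) (x i <= t)%R%:R.

Let ecdf_nd : nondecreasing ecdf.
Proof.
move=> s t st; rewrite ler_wpM2l ?invr_ge0//; apply: ler_sum => i _.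
by rewrite ler_nat; case: leP => // h; rewrite (le_trans h st).
Qed.

Let ecdf_rc : right_continuous ecdf.
Proof.
move=> a; apply: cvgM; [exact: cvg_cst|]; apply: cvg_big => [|i _]; first exact: add_continuous.
apply: cvg_near_cst.
have [h|h] := leP (x i) a; near=> t.
  by rewrite (le_trans h)// ltW.
by rewrite leNgt (_ : t < x i)//; near: t; exact: nbhs_right_lt.
Unshelve. all: by end_near. Qed.

HB.instance Definition _ := isCumulative.Build R _ R ecdf ecdf_nd ecdf_rc.

Let ecdfNy : ecdf @ -oo --> (0 : R).
Proof.
have -> : (0 : R) = n.+1%:R^-1 * \sum_(i < n.+1) 0 by rewrite big1 ?mulr0.
apply: cvgM; [exact: cvg_cst|]; apply: cvg_big => [|i _]; first exact: add_continuous; apply: cvg_near_cst; near=> t.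
by rewrite leNgt (_ : t < x i)//; near: t; apply: nbhs_ninfty_lt; rewrite num_real.
Unshelve. all: by end_near. Qed.

Let ecdfy : ecdf @ +oo --> (1 : R).
Proof.
have -> : (1 : R) = n.+1%:R^-1 * \sum_(i < n.+1) 1.
  by rewrite sumr_const card_ord mulVf// pnatr_eq0.
apply: cvgM; [exact: cvg_cst|]; apply: cvg_big => [|i _]; first exact: add_continuous; apply: cvg_near_cst; near=> t.
by rewrite (_ : x i <= t)//; near: t; apply: nbhs_pinfty_ge; rewrite num_real.
Unshelve. all: by end_near. Qed.

HB.instance Definition _ := isCumulativeBounded.Build R 0 1 ecdf ecdfNy ecdfy.

End empirical_cdf.

Local Open Scope ereal_scope.

Section wasserstein.
Context {R : realType}.
Notation RR := (measurableTypeR R * measurableTypeR R)%type.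

(* [pi] is a joint distribution on the plane with marginal CDFs F and G. *)
Definition coupling (F G : CDF R) (pi : probability RR R) : Prop :=
  (forall s : R, pi [set z | (z.1 <= s)%R] = (F s)%:E) /\
  (forall s : R, pi [set z | (z.2 <= s)%R] = (G s)%:E).

Definition W1 (F G : CDF R) : \bar R :=
  ereal_inf [set \int[pi]_z `|z.1 - z.2|%:E
            | pi in [set pi : probability RR R | coupling F G pi]].

End wasserstein.

(* The right-hand side is a sum of nonnegative extended reals: W1 F G and the
   two tail integrals may be infinite. *)
Definition T2 (R : realType) (rho : risk_measure R)
    (a1 a2 a3 L1 L2 L3 K1 K2 gamma : R) : Prop :=
  [/\ (0 < a1 <= 1)%R, (0 < a2)%R & (0 < a3)%R] /\
  [/\ (0 < L1)%R, (0 < L2)%R & (0 < L3)%R] /\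
  [/\ (0 < K1 <= 1)%R, (0 < K2 <= 1)%R & (0 < gamma)%R] /\
  forall (F G : CDF R) (tau : R), (0 < tau)%R ->
    `|rho F - rho (trunc G tau)|%:E <=
      L1%:E * W1 F G `^ a1 * (tau `^ gamma)%:E
      + L2%:E * \int[lebesgue_measure]_(z in `[(K1 * tau)%R, +oo[)
                  ((1 - F z) `^ a2)%:E
      + L3%:E * \int[lebesgue_measure]_(z in `]-oo, (- (K2 * tau))%R])
                  ((F z) `^ a3)%:E.

Definition has_CDF d (T : measurableType d) (R : realType)
    (P : probability T R) (X : {RV P >-> R}) (F : CDF R) : Prop :=
  forall r : R, cdf X r = (F r)%:E.

Definition mutually_independent d (T : measurableType d) (R : realType)
    (P : probability T R) (I : finType) (X : I -> {RV P >-> R}) : Prop :=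
  forall (J : {set I}) (A : I -> set R),
    (forall i, i \in J -> measurable (A i)) ->
    P [set w | forall i, i \in J -> A i (X i w)] =
    \prod_(i in J) P (X i @^-1` A i).

Definition iid_sample d (T : measurableType d) (R : realType)
    (P : probability T R) (n : nat) (X : 'I_n -> {RV P >-> R}) (F : CDF R) :
    Prop :=
  mutually_independent X /\ forall i, has_CDF (X i) F.

(* [rho] is an arbitrary map, so an event about [rho F_n] need not be measurable
   when the probability space is not complete. Probabilities of such events are
   therefore given by the outer measure of [P], which extends [P]. *)
Definition Prob d (T : measurableType d) (R : realType)
    (P : probability T R) (A : set T) : \bar R := mu_ext P A.

Lemma Prob_measurable d (T : measurableType d) (R : realType)
  (P : probability T R) (A : set T) : measurable A -> Prob P A = P A.
Proof. exact: measurable_mu_extE. Qed.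

(* Main.v *)
(** On [-B2, B1] the truncation of F at tau is F itself and both tail integrals
    vanish, so |rho F_n - rho F| <= L1 * W1(F_n, F)^a1 * tau^gamma almost
    surely. The quantile coupling bounds W1(F_n, F) by the integral of |F_n - F|
    over [-B2, B1]. For a probability measure Q on the line, Jensen and Tonelli
    give
      E exp(l * int |F_n - F| dQ) <= int E exp(l * |F_n(x) - F(x)|) dQ(x),
    and for each x the inner expectation is at most 2 exp(2 l^2 / n), F_n(x)
    being a mean of independent Bernoulli variables. Taking Q uniform on
    [-B2, B1], Markov's inequality with l = n t / 4 gives a Gaussian tail
    without any estimate of the mean of W1(F_n, F). *)

Require Import Defs.
From HB Require Import structures.
From mathcomp Require Import all_boot all_order all_algebra.
From mathcomp Require Import all_classical all_reals all_analysis.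
From mathcomp Require Import measurable_realfun ring lra.

Set Implicit Arguments.
Unset Strict Implicit.
Unset Printing Implicit Defensive.

Import Order.TTheory GRing.Theory Num.Theory.
Import numFieldNormedType.Exports.

Local Open Scope classical_set_scope.
Local Open Scope ring_scope.

(** * Distribution functions and their quantiles *)

(** A risk measure takes the packed CDF, so pointwise equality has to be lifted to the structure;
    its other fields are propositions, equal by proof irrelevance. *)
Lemma CDF_ext (R : realType) (F G : CDF R) : (forall x, F x = G x) -> F = G.
Proof.
case: F G => [f [[f1 f2] [f3 f4]]] [g [[g1 g2] [g3 g4]]] /= fg.
have {}fg : f = g by apply/funext => x; exact: fg.
subst g; by rewrite (Prop_irrelevance f1 g1) (Prop_irrelevance f2 g2)
  (Prop_irrelevance f3 g3) (Prop_irrelevance f4 g4).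
Qed.

(* Outside 0 < u < 1 the set may be empty or unbounded below, and inf is then a
   junk value. *)
Definition quantile (R : realType) (F : CDF R) (u : R) : R :=
  inf [set x | u <= F x].

(** By the limits of [F] at both ends, [0 < u] makes the set bounded below and [u < 1] makes it
    nonempty; right continuity of [F] makes its infimum attained. *)
Lemma quantile_le (R : realType) (F : CDF R) (u x : R) : 0 < u < 1 ->
  (quantile F u <= x) = (u <= F x).
Proof.
move=> /andP[u0 u1].
have lbF : has_lbound [set x | u <= F x].
  have /cvgrPdist_lt/(_ _ u0)[M [_ HM]] := cumulativeNy F.
  exists (M - 1) => y /= uy; rewrite leNgt; apply/negP => yM.
  have /HM : y < M by rewrite (lt_trans yM)// ltrBlDr ltrDl.
  by rewrite sub0r normrN ger0_norm ?CDF_ge0// ltNge uy.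
have neF : [set x | u <= F x] !=set0.
  have u1' : 0 < 1 - u by rewrite subr_gt0.
  have /cvgrPdist_lt/(_ _ u1')[M [_ HM]] := cumulativey F.
  exists (M + 1) => /=.
  have /HM : M < M + 1 by rewrite ltrDl.
  by rewrite ger0_norm ?subr_ge0 ?CDF_le1// => h; lra.
apply/idP/idP => [qx|]; last by move=> h; apply: ge_inf.
rewrite leNgt; apply/negP => Fxu.
have uF : 0 < u - F x by rewrite subr_gt0.
have := @cumulative_is_right_continuous _ _ _ F x.
move=> /cvgrPdist_lt/(_ _ uF)[e /= e0 He].
have : quantile F u < x + e by rewrite (le_lt_trans qx)// ltrDl.
move=> /inf_lt => /(_ neF)[y /= uy yxe].
have Fxy : F x < F y by exact: lt_le_trans uy.
have xy : x < y.
  rewrite ltNge; apply/negP => yx.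
  by have := @cumulative_is_nondecreasing _ _ _ F _ _ yx; rewrite leNgt Fxy.
have := He y; rewrite /ball /=; move=> /(_ _ xy).
have -> : `|x - y| < e.
  by rewrite distrC gtr0_norm ?subr_gt0// ltrBlDr addrC.
move=> /(_ isT).
by rewrite distrC gtr0_norm ?subr_gt0// ltrD2r ltNge uy.
Qed.

Lemma measurable_quantile (R : realType) (F : CDF R) :
  measurable_fun (`]0, 1[ : set R) (quantile F).
Proof.
move=> mD; apply: (measurability (@RGenOInfty.G R)) => //.
  exact: RGenOInfty.measurableE.
move=> /= _ [_] [r] -> <-.
rewrite (_ : _ `&` _ = `]0, 1[ `&` `]F r, +oo[); first by apply: measurableI.
apply/seteqP; split=> u /=; rewrite !in_itv/= !andbT => -[u01 h]; split=> //;
  by move: h; rewrite (ltNge r) (ltNge (F r)) quantile_le.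
Qed.

(** * Layer-cake identities and the quantile coupling *)

Lemma measurable_natr_bool d (T : measurableType d) (R : realType)
    (b : T -> bool) :
  measurable [set x | b x] -> measurable_fun setT (fun x => (b x)%:R : R).
Proof.
move=> mb; rewrite (_ : (fun _ => _) = \1_[set x | b x] :> (T -> R)).
  exact: measurable_indic.
by apply/funext => x; rewrite indicE mem_setE.
Qed.

Lemma measurable_indic_epigraph d (T : measurableType d) (R : realType)
    (f : T -> R) : measurable_fun setT f ->
  measurable_fun setT (fun z : T * R => (f z.1 <= z.2)%R%:R : R).
Proof.
move=> mf; apply: measurable_natr_bool.
have h : measurable_fun setT (fun z : T * R => (f z.1 <= z.2)%R).
  by apply: measurable_fun_ler => //; exact: measurableT_comp.
have := h measurableT [set true] I; rewrite setTI.
by congr measurable; apply/seteqP; split => z /= ->.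
Qed.

Local Open Scope ereal_scope.

(** The integrand is the indicator of the interval between [a] and [b]; this turns a distance of
    quantiles into an integral over levels [x]. *)
Lemma integral_indic_dist (R : realType) (a b : R) :
  \int[lebesgue_measure]_x `|(a <= x)%R%:R - (b <= x)%R%:R|%:E = `|a - b|%:E.
Proof.
wlog ab : a b / (a <= b)%R => [h|].
  have [/h//|/ltW ba] := leP a b.
  rewrite distrC -h//; apply: eq_integral => x _; by rewrite distrC.
transitivity (\int[lebesgue_measure]_x (\1_(`[a, b[ : set R) x)%:E).
  apply: eq_integral => x _; rewrite indicE mem_setE in_itv/=.
  have [ax|xa] := leP a x; have [bx|xb] := leP b x => /=.
  - by rewrite subrr normr0.
  - by rewrite subr0 normr1.
  - by have := lt_le_trans xa (le_trans ab bx); rewrite ltxx.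
  - by rewrite subrr normr0.
rewrite integral_indic//= setIT lebesgue_measure_itv/= lte_fin.
rewrite distrC ger0_norm ?subr_ge0//.
by case: ltP => // ba; rewrite (@le_anti _ _ a b) ?ab// subrr.
Qed.

(** The dual form, with the thresholds on the other side; restriction to [A] can lose mass, hence an
    inequality. *)
Lemma integral_indic_dist_le (R : realType) (a b : R) (A : set R) :
  measurable A ->
  \int[lebesgue_measure]_(u in A) `|(u <= a)%R%:R - (u <= b)%R%:R|%:E
  <= `|a - b|%:E.
Proof.
move=> mA; wlog ab : a b / (a <= b)%R => [h|].
  have [/h//|/ltW ba] := leP a b.
  rewrite distrC; apply: le_trans (h _ _ ba).
  by under eq_integral do rewrite distrC.
apply: (@le_trans _ _ (\int[lebesgue_measure]_(u in A)
    (\1_(`]a, b] : set R) u)%:E)).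
  rewrite le_eqVlt; apply/orP; left; apply/eqP/eq_integral => u _.
  rewrite indicE mem_setE in_itv/=.
  have [ua|au] := leP u a; have [ub|bu] := leP u b => /=.
  - by rewrite subrr normr0.
  - by have := lt_le_trans bu (le_trans ua ab); rewrite ltxx.
  - by rewrite sub0r normrN normr1.
  - by rewrite subrr normr0.
rewrite integral_indic//=.
apply: (@le_trans _ _ (lebesgue_measure (`]a, b] : set R))).
  by rewrite le_measure ?inE//; exact: measurableI.
rewrite lebesgue_measure_itv/= lte_fin distrC ger0_norm ?subr_ge0//.
by case: ltP => // _; rewrite lee_fin subr_ge0.
Qed.

Lemma uniform_prob01 (R : realType) (A : set R) : measurable A ->
  uniform_prob (@ltr01 R) A = lebesgue_measure (A `&` `]0%R, 1%R[).
Proof.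
move=> mA; have := integral_indic (uniform_prob (@ltr01 R)) measurableT mA.
rewrite setIT => <-; rewrite integral_uniform//; last first.
  exact/measurable_EFinP/measurable_indic.
rewrite subr0 invr1 mul1e integral_itv_bndoo ?integral_indic//.
exact/measurable_EFinP/measurable_funTS/measurable_indic.
Qed.

(** Both quantile functions applied to one uniform variable [u] give the coupling. Its cost is the
    double integral of the indicator that [x] separates the two quantiles. By [quantile_le] this
    says that [u] separates [F x] and [G x], so integrating in [u] first gives at most
    [|F x - G x|]. *)
Lemma W1_le (R : realType) (F G : CDF R) :
  W1 F G <= \int[lebesgue_measure]_x `|F x - G x|%:E.
Proof.
pose U : probability (measurableTypeR R) R := uniform_prob (@ltr01 R).
(* Extension by zero off the open unit interval discards the junk values of [quantile] and gives a
   map measurable on the whole line. *)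
pose q (H : CDF R) : R -> R := quantile H \_ `]0%R, 1%R[.
have mq H : measurable_fun [set: measurableTypeR R] (q H).
  apply: (iffLR (measurable_restrictT _ _)); first exact: measurable_itv.
  exact: (@measurable_quantile R H).
have qE H u x : (0 < u < 1)%R -> (q H u <= x)%R = (u <= H x)%R.
  by move=> u01; rewrite /q patchE mem_setE in_itv/= u01 quantile_le.
pose f (u : measurableTypeR R) : measurableTypeR R * measurableTypeR R :=
  (q F u, q G u).
have mf : measurable_fun setT f by apply: measurable_fun_pair; exact: mq.
pose f' : {mfun _ >-> _} := HB.pack f (isMeasurableFun.Build _ _ _ _ f mf).
have Uq H s : U [set u | (q H u <= s)%R] = (H s)%:E.
  rewrite [LHS]uniform_prob01; last first.
    have := mq H measurableT `]-oo, s]%classic (measurable_itv _).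
    by rewrite setTI; congr measurable.
  (* When [H s = 1], the point 1 lies in []0, H s]] but not in the open unit interval; removing it
     costs measure zero. *)
  rewrite (_ : _ `&` _ = `]0%R, H s] `\` [set 1%R]); last first.
    apply/seteqP; split=> u /=; rewrite !in_itv/=.
      move=> [+ u01]; rewrite qE// => uH; split.
        by case/andP: u01 => -> _.
      by move=> u1; move: u01; rewrite u1 ltxx andbF.
    move=> [/andP[u0 uH] u1].
    have u01 : (0 < u < 1)%R.
      rewrite u0 lt_neqAle (le_trans uH (CDF_le1 _ _)) andbT; exact/eqP.
    by rewrite qE.
  rewrite measureD//=.
  - rewrite lebesgue_measure_itv/= lte_fin (_ : _ (_ `&` _) = 0) ?sube0.
      case: ltP => // H0; congr EFin.
      by apply/le_anti; rewrite H0 CDF_ge0.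
    apply/eqP; rewrite eq_le measure_ge0 andbT.
    rewrite -(lebesgue_measure_set1 (1%R:R)) le_measure// inE//=.
    exact: measurableI.
  - by rewrite lebesgue_measure_itv/=; case: ifP => //; rewrite ltry.
apply: (@le_trans _ _ (\int[distribution U f']_z `|z.1 - z.2|%:E)).
  apply: ereal_inf_lbound; exists (distribution U f') => //.
  by split=> s; exact: Uq.
rewrite ge0_integral_distribution//=; last first.
  apply/measurable_EFinP/measurableT_comp => //.
  exact: measurable_funB.
under eq_integral do rewrite -integral_indic_dist.
have mh : measurable_fun setT (fun z : measurableTypeR R * R =>
    `|(q F z.1 <= z.2)%R%:R - (q G z.1 <= z.2)%R%:R|%:E : \bar R).
  apply/measurable_EFinP/measurableT_comp => //.
  by apply: measurable_funB; exact: measurable_indic_epigraph.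
have /= fub := fubini_tonelli (m1 := U) (m2 := lebesgue_measure) _ mh
  (fun z => normr_ge0 _).
rewrite [leLHS]fub.
apply: ge0_le_integral => //=.
- by move=> x _; apply: integral_ge0.
- apply: (measurable_fun_fubini_tonelli_G (m1 := U)
    (fun z : measurableTypeR R * R =>
       `|(q F z.1 <= z.2)%R%:R - (q G z.1 <= z.2)%R%:R|%:E : \bar R)) => //.
- apply/measurable_EFinP/measurableT_comp => //.
  by apply: measurable_funB; apply: nondecreasing_measurable => //;
    exact: cumulative_is_nondecreasing.
move=> x _; have mhx := measurable_fun_pair1 x mh.
rewrite integral_uniform//= subr0 invr1 mul1e integral_itv_bndoo; last first.
  exact: measurable_funTS.
apply: le_trans (integral_indic_dist_le (F x) (G x)
  (measurable_itv `]0%R, 1%R[)).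
rewrite le_eqVlt; apply/orP; left; apply/eqP/eq_integral => u.
by rewrite inE/= in_itv/= => u01; rewrite !qE.
Qed.

(** * Exponential moments of the empirical distribution function *)

(** A weak form of Hoeffding's lemma: the constant 2 in place of the sharp 1/8 allows an elementary
    proof. *)
Lemma bernoulli_mgf_le (R : realType) (p s : R) :
  (0 <= p <= 1 -> 0 <= s ->
   1 + p * (expR s - 1) <= expR (p * s + 2 * s ^+ 2))%R.
Proof.
move=> /andP[p0 p1] s0; have [s2|s2] := leP s (2^-1)%R.
  apply: le_trans (expR_ge1Dx _) _; rewrite ler_expR.
  (* This follows from [expR s * (1 - s) <= 1], as [(1 - s) * (1 + s + 2 * s ^+ 2) = 1 + s ^+ 2 * (1
     - 2 * s)] is at least 1. *)
  have : (expR s <= 1 + s + 2 * s ^+ 2)%R.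
    have h1 : (0 < 1 - s)%R by lra.
    have h2 := expR_ge1Dx (- s)%R; have h3 := expRxMexpNx_1 s.
    have h4 : (expR s * (1 - s) <= 1)%R.
      by rewrite -[leRHS]h3 ler_wpM2l ?expR_ge0.
    have h5 : (0 <= s ^+ 2 * (1 - 2 * s))%R by rewrite mulr_ge0 ?sqr_ge0//; lra.
    by rewrite -(ler_pM2r h1); apply: (le_trans h4); nra.
  by move=> h; nra.
(* For [s > 1/2] this crude bound is enough, since then [s <= 2 * s ^+ 2]. *)
have h : (1 + p * (expR s - 1) <= expR s)%R.
  by have := expR_ge1Dx s; nra.
by apply: le_trans h _; rewrite ler_expR; nra.
Qed.

(* Expanding the product over subsets turns it into a nonnegative combination of
   indicators of intersections. *)
Lemma integral_prod_indic d (T : measurableType d) (R : realType)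
    (P : probability T R) (I : finType) (X : I -> {RV P >-> R}) (A : set R)
    (c p : R) :
  mutually_independent X -> measurable A -> (0 <= c)%R ->
  (forall i, P (X i @^-1` A) = p%:E) ->
  \int[P]_w (\prod_(i : I) (1 + c * \1_A (X i w)))%:E
  = ((1 + c * p) ^+ #|I|)%:E.
Proof.
move=> indX mA c0 pE.
have expand (a : I -> R) : (\prod_(i : I) (1 + a i) =
    \sum_(J : {set I}) \prod_(i in J) a i)%R.
  under eq_bigr do rewrite addrC.
  by rewrite bigA_distr; apply: eq_bigr => J _; rewrite -big_mkcond.
have prodE (J : {set I}) w : (\prod_(i in J) (c * \1_A (X i w)))%R =
    (c ^+ #|J| * \1_[set w | forall i, i \in J -> A (X i w)] w)%R.
  rewrite big_split/= prodr_const; congr (_ * _)%R.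
  rewrite [in RHS]indicE; have [/set_mem h|/negP h] := boolP (_ \in _).
    by rewrite big1// => i iJ; rewrite indicE mem_set//; exact: h.
  apply/eqP/prodf_eq0; apply: contrapT => h'.
  apply: h; apply/mem_set => i iJ /=.
  apply: contrapT => nA; apply: h'; exists i => //.
  by rewrite indicE memNset.
have mJ (J : {set I}) : measurable [set w | forall i, i \in J -> A (X i w)].
  rewrite (_ : [set _ | _] = \bigcap_(i in [set i | i \in J]) (X i @^-1` A)).
    apply: fin_bigcap_measurable => // i _.
    by rewrite -[X in measurable X]setTI; exact: measurable_funPT.
  by [].
under eq_integral => w _.
  rewrite expand -sumEFin; under eq_bigr do rewrite prodE EFinM.
  over.
rewrite ge0_integral_sum//=; last 2 first.
- by move=> J; apply: measurable_funeM; exact/measurable_EFinP/measurable_indic.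
- by move=> J w _; rewrite mule_ge0// lee_fin// exprn_ge0.
rewrite -[in RHS]prodr_const (expand (fun=> (c * p)%R)) -sumEFin.
apply: eq_bigr => J _; rewrite ge0_integralZl//; last 2 first.
- exact/measurable_EFinP/measurable_indic.
- by rewrite lee_fin exprn_ge0.
rewrite integral_indic// setIT.
have /= -> := indX J (fun=> A) (fun _ _ => mA).
under [X in _ * X]eq_bigr do rewrite pE.
by rewrite prodEFin -EFinM big_split/= !prodr_const.
Qed.

(** Turns a lower deviation of [ecdf] into an upper deviation of the frequency of the complementary
    half-line, so one exponential bound serves both signs. *)
Lemma ecdf_ccdf (R : realType) (n : nat) (x : 'I_n.+1 -> R) (t : R) :
  (1 - ecdf x t = n.+1%:R^-1 * \sum_(i < n.+1) (t < x i)%R%:R)%R.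
Proof.
have n0 : (n.+1%:R : R) != 0%R by rewrite pnatr_eq0.
have e : (\sum_(i < n.+1) (t < x i)%R%:R + \sum_(i < n.+1) (x i <= t)%R%:R
    = n.+1%:R :> R)%R.
  rewrite -big_split/= (eq_bigr (fun=> 1%R)) ?sumr_const ?card_ord// => i _.
  by case: leP; rewrite ?addr0 ?add0r.
by apply: (mulfI n0); rewrite mulrBr mulr1 !mulVKf//= -e addrK.
Qed.

(** An indicator takes only the values 0 and 1, so each factor of the exponential is affine in it,
    the shape that [integral_prod_indic] evaluates. With [s = l / n.+1] the linear terms cancel and
    the quadratic ones add up to [2 * l ^+ 2 / n.+1]. *)
Lemma mean_indic_mgf_le d (T : measurableType d) (R : realType)
    (P : probability T R) (n : nat) (X : 'I_n.+1 -> {RV P >-> R}) (A : set R)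
    (p l : R) :
  mutually_independent X -> measurable A -> (0 <= l)%R ->
  (forall i, P (X i @^-1` A) = p%:E) ->
  \int[P]_w (expR (l * (n.+1%:R^-1 * \sum_(i < n.+1) \1_A (X i w) - p)))%:E
  <= (expR (2 * l ^+ 2 / n.+1%:R))%:E.
Proof.
move=> indX mA l0 pE; have n0 : (n.+1%:R : R) != 0%R by rewrite pnatr_eq0.
pose s := (l / n.+1%:R)%R; have s0 : (0 <= s)%R by rewrite divr_ge0.
have es0 : (0 <= expR s - 1)%R by rewrite subr_ge0 -expR0 ler_expR.
have p01 : (0 <= p <= 1)%R.
  rewrite -!lee_fin -(pE ord0) measure_ge0 probability_le1//.
  by rewrite -[X in measurable X]setTI; exact: measurable_funPT.
have prodE w : (expR (l * (n.+1%:R^-1 * \sum_(i < n.+1) \1_A (X i w) - p)) =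
    expR (- (l * p)) * \prod_(i < n.+1) (1 + (expR s - 1) * \1_A (X i w)))%R.
  rewrite mulrBr addrC expRD mulrA -/s mulr_sumr expR_sum; congr (_ * _)%R.
  apply: eq_bigr => i _; rewrite indicE; case: (_ \in _).
    by rewrite !mulr1 addrC subrK.
  by rewrite !mulr0 expR0 addr0.
under eq_integral do rewrite prodE EFinM.
rewrite ge0_integralZl//; last 2 first.
- apply/measurable_EFinP/measurable_prod => i _.
  apply: measurable_funD => //; apply: measurable_funM => //.
  by apply: measurableT_comp => //; exact: measurable_indic.
- move=> w _; rewrite lee_fin; apply: prodr_ge0 => i _.
  by rewrite addr_ge0// mulr_ge0.
rewrite (integral_prod_indic indX mA es0 pE) -EFinM lee_fin card_ord.
apply: (@le_trans _ _ (expR (- (l * p)) * expR (p * s + 2 * s ^+ 2) ^+ n.+1)%R).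
  rewrite ler_wpM2l ?expR_ge0// lerXn2r ?nnegrE ?expR_ge0//.
    by rewrite addr_ge0// mulr_ge0//; case/andP: p01.
  by rewrite mulrC; exact: bernoulli_mgf_le.
rewrite -expRM_natl -expRD ler_expR le_eqVlt; apply/orP; left; apply/eqP.
by rewrite /s; field.
Qed.

Lemma measurable_ecdf d (T : measurableType d) (R : realType) (n : nat)
    (X : 'I_n.+1 -> T -> R) : (forall i, measurable_fun setT (X i)) ->
  measurable_fun setT (fun z : T * R => ecdf (X ^~ z.1) z.2).
Proof.
move=> mX; apply: measurable_funM => //; apply: measurable_sum => i.
exact: measurable_indic_epigraph.
Qed.

(** Bounding [expR |y|] by [expR y + expR (- y)] produces the factor 2. *)
Lemma ecdf_deviation_mgf_le d (T : measurableType d) (R : realType)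
    (P : probability T R) (n : nat) (X : 'I_n.+1 -> {RV P >-> R}) (F : CDF R)
    (l x : R) : iid_sample X F -> (0 <= l)%R ->
  \int[P]_w (expR (l * `|ecdf (X ^~ w) x - F x|))%:E
  <= (2 * expR (2 * l ^+ 2 / n.+1%:R))%:E.
Proof.
move=> [indX cdfX] l0.
have mF : measurable_fun setT (fun w => ecdf (X ^~ w) x).
  by apply: (measurable_fun_pair1 x (measurable_ecdf (X := X) _)).
have mup : measurable_fun setT
    (fun w => (expR (l * (ecdf (X ^~ w) x - F x)))%:E).
  apply/measurable_EFinP/measurableT_comp => //; apply: measurable_funM => //.
  exact: measurable_funB.
have mdown : measurable_fun setT
    (fun w => (expR (l * (F x - ecdf (X ^~ w) x)))%:E).
  apply/measurable_EFinP/measurableT_comp => //; apply: measurable_funM => //.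
  exact: measurable_funB.
apply: (@le_trans _ _ (\int[P]_w ((expR (l * (ecdf (X ^~ w) x - F x)))%:E +
    (expR (l * (F x - ecdf (X ^~ w) x)))%:E))).
  apply: ge0_le_integral => //=.
  - apply/measurable_EFinP/measurableT_comp => //; apply: measurable_funM => //.
    by apply: measurableT_comp => //; exact: measurable_funB.
  - exact: emeasurable_funD.
  move=> w _; rewrite -EFinD lee_fin.
  have [h|h] := leP (F x) (ecdf (X ^~ w) x).
    by rewrite ger0_norm ?subr_ge0// lerDl expR_ge0.
  by rewrite ltr0_norm ?subr_lt0// opprB lerDr expR_ge0.
rewrite ge0_integralD//= mulr_natl mulr2n EFinD; apply: leeD.
  have eq1 w : (n.+1%:R^-1 * \sum_(i < n.+1) \1_(`]-oo, x]%classic) (X i w)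
      = ecdf (X ^~ w) x)%R.
    congr (_ * _)%R; apply: eq_bigr => i _.
    by rewrite indicE mem_setE in_itv.
  have := @mean_indic_mgf_le _ _ _ P n X `]-oo, x]%classic (F x) l indX
    (measurable_itv _) l0 (cdfX ^~ x).
  by under eq_integral do rewrite eq1.
have cX i : P (X i @^-1` `]x, +oo[%classic) = (1 - F x)%:E.
  have := cdf_ccdf_1 (X i) x; rewrite (cdfX i x).
  move=> /(congr1 (fun z => z - (F x)%:E)).
  by rewrite /= addeAC subee// add0e EFinB.
have eq2 w : (n.+1%:R^-1 * \sum_(i < n.+1) \1_(`]x, +oo[%classic) (X i w)
    - (1 - F x) = F x - ecdf (X ^~ w) x)%R.
  rewrite (_ : F x - _ = (1 - ecdf (X ^~ w) x) - (1 - F x))%R; last by ring.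
  rewrite ecdf_ccdf; congr (_ * _ - _)%R; apply: eq_bigr => i _.
  by rewrite indicE mem_setE in_itv/= andbT.
have := @mean_indic_mgf_le _ _ _ P n X `]x, +oo[%classic (1 - F x) l indX
  (measurable_itv _) l0 cX.
by under eq_integral do rewrite eq2.
Qed.

(** * Tail of the averaged deviation *)

Lemma integral_probability_cst d (T : measurableType d) (R : realType)
    (P : probability T R) (c : R) : \int[P]_x c%:E = c%:E.
Proof.
rewrite integral_cst// -[RHS]mule1; congr (_ * _); exact: probability_setT.
Qed.

(* Jensen's inequality, by integrating the tangent line of expR at v. *)
Lemma expR_le_integral d (T : measurableType d) (R : realType)
    (P : probability T R) (g : T -> R) (v : R) :
  measurable_fun setT g -> (forall x, 0 <= g x)%R ->
  \int[P]_x (g x)%:E = v%:E -> (expR v)%:E <= \int[P]_x (expR (g x))%:E.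
Proof.
move=> mg g0 gv.
have v0 : (0 <= v)%R.
  by rewrite -lee_fin -gv integral_ge0// => x _; rewrite lee_fin.
have mgE : measurable_fun setT (fun x => (g x)%:E) by exact/measurable_EFinP.
have meg : measurable_fun setT (fun x => (expR (g x))%:E).
  by apply/measurable_EFinP; exact: measurableT_comp.
have ev := expR_gt0 v.
have lhsE : \int[P]_x ((expR v)%:E + (expR v)%:E * (g x)%:E) =
    (expR v)%:E + (v * expR v)%:E.
  rewrite ge0_integralD//=.
  - rewrite integral_probability_cst ge0_integralZl ?lee_fin ?expR_ge0//.
      by rewrite gv -EFinM mulrC.
    by move=> x _; rewrite lee_fin.
  - by move=> x _; rewrite -EFinM lee_fin mulr_ge0// expR_ge0.
  - exact: measurable_funeM.
have rhsE : \int[P]_x ((expR (g x))%:E + (v * expR v)%:E) =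
    \int[P]_x (expR (g x))%:E + (v * expR v)%:E.
  rewrite ge0_integralD//= ?integral_probability_cst//.
  by move=> _ _; rewrite lee_fin mulr_ge0// expR_ge0.
rewrite -(leeD2rE (x := (v * expR v)%:E))// -lhsE -rhsE.
apply: ge0_le_integral => //=.
- by move=> x _; rewrite -EFinM -EFinD lee_fin addr_ge0// ?mulr_ge0// expR_ge0.
- by apply: emeasurable_funD => //; exact: measurable_funeM.
- exact: emeasurable_funD.
move=> x _; rewrite -EFinM -!EFinD lee_fin.
have := ler_wpM2l (ltW ev) (expR_ge1Dx (g x - v)).
by rewrite -expRD subrKC => h; lra.
Qed.

(** Measurability of the event is part of the conclusion, so that outer measure can later be
    replaced by [P]. *)
Lemma ecdf_L1_tail d (T : measurableType d) (R : realType)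
    (P : probability T R) (n : nat) (X : 'I_n.+1 -> {RV P >-> R}) (F : CDF R)
    (Q : probability (measurableTypeR R) R) (t : R) :
  iid_sample X F -> (0 <= t)%R ->
  let V w := \int[Q]_x `|ecdf (X ^~ w) x - F x|%:E in
  measurable [set w | t%:E <= V w] /\
  P [set w | t%:E <= V w] <= (2 * expR (- (n.+1%:R * t ^+ 2 / 8)))%:E.
Proof.
move=> iidX t0 V; pose S := [set w | t%:E <= V w].
have mdev : measurable_fun setT
    (fun z : T * measurableTypeR R => `|ecdf (X ^~ z.1) z.2 - F z.2|%R).
  apply: measurableT_comp => //; apply: measurable_funB.
    by apply: (measurable_ecdf (X := X)) => i.
  apply: measurableT_comp => //; apply: nondecreasing_measurable => //.
  exact: cumulative_is_nondecreasing.
have mV : measurable_fun setT V.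
  apply: (measurable_fun_fubini_tonelli_F (m2 := Q)
    (fun z : T * measurableTypeR R => `|ecdf (X ^~ z.1) z.2 - F z.2|%:E)) => //.
  exact/measurable_EFinP.
have mS : measurable S.
  by rewrite /S -[X in measurable X]setTI; exact: measurable_lee.
(* This [l] minimises [2 * l ^+ 2 / n.+1 - l * t], with minimum [- n.+1 * t ^+ 2 / 8]. *)
split=> //; pose l : R := (n.+1%:R * t / 4)%R.
have l0 : (0 <= l)%R by rewrite divr_ge0// mulr_ge0.
pose h (z : T * measurableTypeR R) : \bar R :=
  (expR (l * `|ecdf (X ^~ z.1) z.2 - F z.2|))%:E.
have h0 z : 0 <= h z by rewrite lee_fin expR_ge0.
have mh : measurable_fun setT h.
  apply/measurable_EFinP/measurableT_comp => //; exact: measurable_funM.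
have mH := measurable_fun_fubini_tonelli_F (m2 := Q) h mh h0.
have VH w : S w -> (expR (l * t))%:E <= \int[Q]_x h (w, x).
  move=> /= tV; have mdw := measurable_fun_pair2 w mdev.
  (* Both CDFs take values in [[0, 1]]; the bound makes [V w] finite, so that Jensen applies at the
     real number [l * fine (V w)]. *)
  have V1 : V w <= 1.
    apply: (@le_trans _ _ (\int[Q]_x 1)); last first.
      by rewrite integral_probability_cst.
    apply: ge0_le_integral => //; first exact/measurable_EFinP.
    move=> x _; rewrite lee_fin ler_norml.
    have := CDF_ge0 F x; have := CDF_le1 F x.
    have := CDF_ge0 (ecdf (X ^~ w)) x; have := CDF_le1 (ecdf (X ^~ w)) x.
    by move=> /= *; lra.
  have Vfin : V w \is a fin_num.
    by rewrite ge0_fin_numE ?(le_lt_trans V1) ?ltry// integral_ge0.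
  apply: (@le_trans _ _ (expR (l * fine (V w)))%:E).
    by rewrite lee_fin ler_expR ler_wpM2l// -lee_fin fineK.
  apply: expR_le_integral; first exact: measurable_funM.
    by move=> x; rewrite mulr_ge0.
  under eq_integral do rewrite EFinM.
  rewrite ge0_integralZl//; last exact/measurable_EFinP.
  by rewrite [RHS]EFinM (fineK Vfin).
have : (expR (l * t))%:E * P S <= (2 * expR (2 * l ^+ 2 / n.+1%:R))%:E.
  rewrite -integral_cst//.
  apply: (@le_trans _ _ (\int[P]_w \int[Q]_x h (w, x))).
    apply: (@le_trans _ _ (\int[P]_(w in S) \int[Q]_x h (w, x))).
      apply: ge0_le_integral => //.
        by move=> w _; rewrite lee_fin expR_ge0.
      exact: measurable_funTS mH.
    by apply: ge0_subset_integral => // w _; exact: integral_ge0.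
  rewrite (fubini_tonelli _ mh h0).
  apply: (@le_trans _ _ (\int[Q]_x (2 * expR (2 * l ^+ 2 / n.+1%:R))%:E)).
    apply: ge0_le_integral => //.
    - by move=> x _; exact: integral_ge0.
    - exact: (measurable_fun_fubini_tonelli_G (m1 := P) h mh h0).
    - by move=> x _; exact: ecdf_deviation_mgf_le.
  by rewrite integral_probability_cst.
rewrite -[P S]fineK ?fin_num_measure// -EFinM !lee_fin => hS.
rewrite -(ler_pM2l (expR_gt0 (l * t))); apply: (le_trans hS).
rewrite [leRHS]mulrCA -expRD ler_pM2l// ler_expR le_eqVlt.
apply/orP; left; apply/eqP.
have n0 : (n.+1%:R : R) != 0%R by rewrite pnatr_eq0.
by rewrite /l; field.
Qed.

(** * The (T2) inequality and bounded supports *)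

(** The roles are asymmetric: truncation acts on [G] and the tail integrals see [F]. In the
    application [G] is the true CDF and [F] the empirical one. *)
Lemma T2_le (R : realType) (rho : risk_measure R)
    (a1 a2 a3 L1 L2 L3 K1 K2 gamma : R) (F G : CDF R) (tau v : R) :
  T2 rho a1 a2 a3 L1 L2 L3 K1 K2 gamma -> (0 < tau)%R ->
  (forall x, x < - tau -> G x = 0)%R -> (forall x, tau <= x -> G x = 1)%R ->
  (forall x, x < - (K2 * tau) -> F x = 0)%R ->
  (forall x, K1 * tau <= x -> F x = 1)%R ->
  W1 F G <= v%:E ->
  (`|rho F - rho G| <= L1 * v `^ a1 * tau `^ gamma)%R.
Proof.
move=> [[/andP[a10 _] a20 a30] [[L10 _ _] [_ hT2]]] tau0 G0 G1 F0 F1 Wv.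
have GE : (trunc G tau : CDF R) = G.
  apply: CDF_ext => x /=; rewrite /trunc.
  have [tx|xt] := leP tau x; first by rewrite andbF mulr0 add0r G1.
  by rewrite andbT addr0; case: leP => h; rewrite ?mulr1// mulr0 G0.
(* The upper tail integrand is a power of 0, which vanishes because [a2] is nonzero; [powR] of 0 at
   exponent 0 would be 1. *)
have := hT2 F G tau tau0; rewrite GE integral0_eq; last first.
  move=> x /=; rewrite in_itv/= andbT => Kx.
  by rewrite F1// subrr powR0// gt_eqF.
(* [F] may have an atom at [- (K2 * tau)], so this Lebesgue-null endpoint is dropped before the
   integrand is shown to vanish. *)
rewrite -integral_itv_bndo_bndc; last first.
  apply/measurable_EFinP/measurable_funTS.
  apply: (measurableT_comp (measurable_powR _)).
  by apply: nondecreasing_measurable => //; exact: cumulative_is_nondecreasing.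
rewrite [X in _ + _ * X]integral0_eq; last first.
  by move=> x /=; rewrite in_itv/= => xK; rewrite F0// powR0// gt_eqF.
rewrite !mule0 !adde0 => h.
have W0 : 0 <= W1 F G.
  by apply: le_ereal_inf_tmp => _ [pi _ <-]; exact: integral_ge0.
rewrite -lee_fin; apply: (le_trans h).
rewrite 2!EFinM; apply: lee_wpmul2r; first by rewrite lee_fin powR_ge0.
apply: lee_wpmul2l; first by rewrite lee_fin ltW.
rewrite -poweR_EFin; apply: gt0_ler_poweR => //; first exact: ltW.
  by rewrite in_itv/= W0 leey.
by rewrite in_itv/= (le_trans W0 Wv) leey.
Qed.

(** For [x < a] the event [X <= x], and for [b <= x] the event [X > x], lie in the exceptional null
    set. *)
Lemma has_CDF_ae d (T : measurableType d) (R : realType)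
    (P : probability T R) (X : {RV P >-> R}) (F : CDF R) (a b : R) :
  has_CDF X F -> (\forall w \ae P, a <= X w <= b)%R ->
  (forall x, x < a -> F x = 0)%R /\ (forall x, b <= x -> F x = 1)%R.
Proof.
move=> XF aXb.
have null A : measurable A -> (forall r, A r -> ~ (a <= r <= b)%R) ->
    P (X @^-1` A) = 0.
  move=> mA nA; apply: measure_negligible.
    by rewrite -[X in measurable X]setTI; exact: measurable_funPT.
  by apply: negligibleS aXb => w /nA.
split=> x hx.
  apply/EFin_inj; rewrite -XF; apply: (null _ (measurable_itv _)) => r /=.
  rewrite in_itv/= => rx /andP[ar _].
  by have := le_lt_trans (le_trans ar rx) hx; rewrite ltxx.
apply/EFin_inj; rewrite -XF cdf_1_ccdf.
rewrite [ccdf X x](null _ (measurable_itv _)) ?sube0// => r /=.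
rewrite in_itv/= andbT => xr /andP[_ rb].
by have := lt_le_trans xr (le_trans rb hx); rewrite ltxx.
Qed.

(** The samples may live on another probability space than [X]; the support is carried over through
    [F] alone. *)
Lemma has_CDF_ae_itv d (T : measurableType d) (R : realType)
    (P : probability T R) (X : {RV P >-> R}) (F : CDF R) (a b : R) :
  has_CDF X F -> (forall x, x < a -> F x = 0)%R -> F b = 1%R ->
  \forall w \ae P, (a <= X w <= b)%R.
Proof.
move=> XF F0 F1.
have mX (A : set R) : measurable A -> measurable (X @^-1` A).
  by move=> mA; rewrite -[X in measurable X]setTI; exact: measurable_funPT.
have hi : P.-negligible (X @^-1` `]b, +oo[%classic).
  apply/negligibleP; first exact: mX.
  by have := ccdf_1_cdf X b; rewrite (XF b) F1 subee.
(* [F a] may be positive, so the event [X < a] is exhausted by countably many null events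
   [X <= a - 1/(k+1)]. *)
have lo k : P.-negligible (X @^-1` `]-oo, (a - k.+1%:R^-1)%R]%classic).
  apply/negligibleP; first exact: mX.
  rewrite [LHS](XF _) F0// ltrBlDr ltrDl invr_gt0//.
apply: negligibleS (negligibleU (negligible_bigcup lo) hi) => w /= /negP.
rewrite negb_and -!ltNge => /orP[Xa|bX]; last by right; rewrite in_itv/= andbT.
left; have aX : (0 < a - X w)%R by rewrite subr_gt0.
have [k _ hk] := near_infty_natSinv_lt (PosNum aX).
exists k => //=; rewrite in_itv/=.
have h : (k.+1%:R^-1 < a - X w)%R := hk k (leqnn k).
by rewrite lerBrDl -lerBrDr ltW.
Qed.

Close Scope ereal_scope.

(** * Assembly of the concentration bound *)

Theorem theorem34 (R : realType) (B1 B2 : R)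
    (hB1 : 0 <= B1) (hB2 : 0 <= B2) (hB : 0 < B1 \/ 0 < B2) :
  exists c1 c2 : R, 0 < c1 /\ 0 < c2 /\
    forall (d0 : measure_display) (T0 : measurableType d0)
      (P0 : probability T0 R) (X : {RV P0 >-> R}) (F : CDF R)
      (hXF : has_CDF X F)
      (hX : \forall w \ae P0, - B2 <= X w <= B1)
      (rho : risk_measure R) (a1 a2 a3 L1 L2 L3 K1 K2 gamma : R)
      (hrho : T2 rho a1 a2 a3 L1 L2 L3 K1 K2 gamma)
      (d : measure_display) (T : measurableType d) (P : probability T R)
      (n : nat) (Xs : 'I_n.+1 -> {RV P >-> R}) (hXs : iid_sample Xs F)
      (eps : R) (heps : 0 < eps),
    let tau := Num.max (B1 / K1) (B2 / K2) in
    let rho_n := fun w => rho (ecdf (fun i => Xs i w)) in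
    (Prob P [set w | (eps < `|rho_n w - rho F|)%R] <=
     (c1 * expR (- c2 * n.+1%:R
                 * (eps / (L1 * tau `^ gamma)) `^ (2 / a1)))%:E)%E.
Proof.
have D0 : - B2 < B1 by case: hB => ?; lra.
pose D := B1 - - B2; have DE : 0 < D by rewrite subr_gt0.
(* The 2 counts the two signs of the deviation; [8 * D ^+ 2] comes from the exponent of
   [ecdf_L1_tail] at level [t / D]. *)
exists 2, (8 * D ^+ 2)^-1; split=> //; split.
  by rewrite invr_gt0 mulr_gt0// exprn_gt0.
move=> d0 T0 P0 X F hXF hX rho a1 a2 a3 L1 L2 L3 K1 K2 gamma hrho d T P n Xs
  hXs eps eps0; cbv zeta; set tau := Num.max _ _.
have [[/andP[a10 _] _ _] [[L10 _ _] [[/andP[K10 K11] /andP[K20 K21] _] _]]] :=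
  hrho.
have tau0 : 0 < tau.
  rewrite /tau lt_max; case: hB => h; first by rewrite (divr_gt0 h K10).
  by rewrite (divr_gt0 h K20) orbT.
have K1tau : B1 <= K1 * tau.
  by rewrite mulrC -ler_pdivrMr// /tau le_max lexx.
have K2tau : B2 <= K2 * tau.
  by rewrite mulrC -ler_pdivrMr// /tau le_max lexx orbT.
have K1tau_le : K1 * tau <= tau by rewrite ler_piMl// ltW.
have K2tau_le : K2 * tau <= tau by rewrite ler_piMl// ltW.
have [F0 F1] := has_CDF_ae hXF hX.
set r := eps / (L1 * tau `^ gamma).
have r0 : 0 < r by rewrite divr_gt0// mulr_gt0// powR_gt0.
(* The value of the Wasserstein distance at which the bound of [T2_le] equals [eps]. *)
pose t := r `^ a1^-1.
pose Q : probability (measurableTypeR R) R := uniform_prob D0.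
have tD0 : 0 <= t / D by rewrite divr_ge0 ?powR_ge0// ltW.
have [mS] := @ecdf_L1_tail _ _ _ P n Xs F Q (t / D) hXs tD0.
set S := [set w | _] => PS.
have [N [mN PN badN]] : \forall w \ae P, forall i, - B2 <= Xs i w <= B1.
  by apply: filter_forall => i; apply: (has_CDF_ae_itv (hXs.2 i) F0); exact: F1.
(* A deterministic argument: off the measurable sets [S] and [N] the deviation is at most [eps].
   Monotonicity of outer measure then handles the possibly nonmeasurable event. *)
have sub : [set w | eps < `|rho (ecdf (fun i => Xs i w)) - rho F|] `<=` S `|` N.
  move=> w /= hw; apply: contrapT => /not_orP[nS nN].
  have {nN} good i : - B2 <= Xs i w <= B1.
    by apply: contrapT => h; apply: nN; apply: badN => /(_ i).
  pose H : CDF R := ecdf (fun i => Xs i w).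
  have H0 x : x < - B2 -> H x = 0.
    move=> xB; rewrite /H/= /ecdf big1 ?mulr0// => i _.
    by rewrite leNgt (lt_le_trans xB)//; case/andP: (good i).
  have H1 x : B1 <= x -> H x = 1.
    move=> Bx; rewrite /H/= /ecdf (eq_bigr (fun=> 1)) => [|i _].
      by rewrite sumr_const card_ord mulVf// pnatr_eq0.
    by rewrite (le_trans _ Bx)//; case/andP: (good i).
  pose V := (\int[Q]_x `|H x - F x|%:E)%E.
  have Vt : (V < (t / D)%:E)%E by rewrite ltNge; apply/negP.
  have V0 : (0 <= V)%E by exact: integral_ge0.
  have mHF : measurable_fun [set: R] (fun x => `|H x - F x|).
    apply: measurableT_comp => //.
    by apply: measurable_funB; apply: nondecreasing_measurable => //;
      exact: cumulative_is_nondecreasing.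
  (* Outside [[- B2, B1]] the two CDFs are both 0 or both 1, so the integral over the line is [D]
     times the uniform mean. *)
  have intE : (\int[lebesgue_measure]_x `|H x - F x|%:E = D%:E * V)%E.
    rewrite /V integral_uniform//; last exact/measurable_EFinP.
    rewrite muleA -EFinM mulfV ?gt_eqF// mul1e [RHS]integral_mkcond.
    apply: eq_integral => x _; rewrite patchE mem_setE in_itv/=.
    case: ifPn => //; rewrite negb_and -!ltNge => /orP[h|h].
      by rewrite H0// F0// subrr normr0.
    by rewrite H1 ?F1 ?ltW// subrr normr0.
  have Vfin : V \is a fin_num by rewrite ge0_fin_numE// (lt_trans Vt)// ltry.
  have Wle : (W1 H F <= (D * fine V)%:E)%E.
    by rewrite EFinM fineK// -intE; exact: W1_le.
  have Ft0 x : x < - tau -> F x = 0 by move=> h; apply: F0; lra.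
  have Ft1 x : tau <= x -> F x = 1 by move=> h; apply: F1; lra.
  have Ht0 x : x < - (K2 * tau) -> H x = 0 by move=> h; apply: H0; lra.
  have Ht1 x : K1 * tau <= x -> H x = 1 by move=> h; apply: H1; lra.
  have := lt_le_trans hw (T2_le hrho tau0 Ft0 Ft1 Ht0 Ht1 Wle).
  apply/negP; rewrite -leNgt.
  have -> : eps = L1 * r * tau `^ gamma.
    by rewrite /r mulrAC mulrC divfK// gt_eqF// mulr_gt0// powR_gt0.
  rewrite ler_wpM2r ?powR_ge0// ler_pM2l//.
  have -> : r = t `^ a1 by rewrite /t -powRrM mulVf ?gt_eqF// powRr1// ltW.
  apply: ge0_ler_powR; rewrite ?nnegrE ?powR_ge0 ?(ltW a10)//.
    by rewrite mulr_ge0 ?fine_ge0// ltW.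
  by rewrite mulrC -ler_pdivlMr// -lee_fin fineK// ltW.
have cE : expR (- (n.+1%:R * (t / D) ^+ 2 / 8)) =
    expR (- (8 * D ^+ 2)^-1 * n.+1%:R * r `^ (2 / a1)).
  congr expR.
  have -> : r `^ (2 / a1) = t ^+ 2 by rewrite mulrC powRrM powR_mulrn ?powR_ge0.
  by field; rewrite gt_eqF.
rewrite -cE; apply: (le_trans (le_mu_ext P sub)).
rewrite [leLHS]Prob_measurable; last exact: measurableU.
apply: (le_trans (measureU2 P mS mN)).
by rewrite [X in (_ + X)%E]PN adde0.
Qed.
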